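(* Let $\mathbb{F}_q$ be a finite field, let $n\ge 2$ be a divisor of $q-1$, let $\gamma\in\mathbb{F}_q^*$ have order $n$, and let $G=\langle\gamma\rangle$. Let $N$ be an integer, let $H\le n$ and $s\ge 0$ be integers, and let $S\subseteq\{N+1,\ldots,N+H\}$ have cardinality $|S|=H-s$. Let $f:G\to G$ be any mapping satisfying $f(\gamma^x)=\gamma^{x^2}$ for all $x\in S$. Then $$ind(f)\ge \frac{n}{2(n-H+2s+1)}.$$
   Context: For a positive divisor $\ell$ of $n$, let $C_{\ell,0}=\{\gamma^{j\ell}: j=0,1,\ldots,n/\ell-1\}$ and $C_{\ell,i}=\gamma^i C_{\ell,0}$ for $i=0,1,\ldots,\ell-1$. For a self-mapping $f$ of $G$, $ind(f)$ denotes the smallest positive divisor $\ell$ of $n$ such that there exist a positive integer $r$ and $a_0,\ldots,a_{\ell-1}\in G$ with $f(x)=a_i x^r$ whenever $x\in C_{\ell,i}$, $i=0,\ldots,\ell-1$. *)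

(* Defs.v *)
From HB Require Import structures.
From mathcomp Require Import all_boot all_order all_algebra all_fingroup.
From mathcomp Require Import all_solvable all_field.
From mathcomp Require Import finmap boolp.
Set Implicit Arguments.
Unset Strict Implicit.
Unset Printing Implicit Defensive.

Definition zexpg (gT : finGroupType) (x : gT) (z : int) : gT :=
  match z with
  | Posz k => (x ^+ k)%g
  | Negz k => (x ^- k.+1)%g
  end.

Section Index.

Variables (gT : finGroupType) (g : gT).

(* C_{l,i}, where the order of g is n; meaningful for l %| #[g]. *)
Definition cyc_coset (l i : nat) : {set gT} :=
  (g ^+ i *: [set g ^+ (j * l)%N | j : 'I_(#[g] %/ l)])%g.

Variable f : [subg <[g]> ] -> [subg <[g]> ].

Definition cyclotomic_form (l : nat) : Prop :=
  exists (r : nat) (a : 'I_l -> [subg <[g]> ]),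
    (0 < r)%N /\
    forall (i : 'I_l) (x : [subg <[g]> ]),
      sgval x \in cyc_coset l i -> f x = (a i * x ^+ r)%g.

(* The exponent r is unbounded, hence the classical truth value. *)
Definition index_pred (l : nat) : bool :=
  [&& 0 < l, l %| #[g]%g & `[< cyclotomic_form l >]].

(* l = #[g] always qualifies, with r = 1, so the minimum below exists. *)
Lemma index_pred_ex : exists l, index_pred l.
Proof.
exists #[g]%g; rewrite /index_pred order_gt0 dvdnn /=; apply/asboolP.
pose c (i : nat) : [subg <[g]> ] := subg <[g]>%G (g ^+ i)%g.
exists 1%N, (fun i => (f (c i) * (c i)^-1)%g); split=> // i x.
move=> /lcosetP[_ /imsetP[j _ ->]].
rewrite expgM expgAC expg_order expg1n mulg1 => xE.
have -> : x = c i by rewrite /c -xE sgvalK.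
by rewrite expg1 mulgKV.
Qed.

Definition ind : nat := ex_minn index_pred_ex.

End Index.

(* Main.v *)
Require Import Defs.
From HB Require Import structures.
From mathcomp Require Import all_boot all_order all_algebra all_fingroup.
From mathcomp Require Import all_solvable all_field.
From mathcomp Require Import finmap boolp.
From mathcomp Require Import zify ring.
Set Implicit Arguments.
Unset Strict Implicit.
Unset Printing Implicit Defensive.
Import Order.TTheory GRing.Theory Num.Theory.
Local Open Scope ring_scope.

(* Put l = ind f and m = n / l.  When f (g^i) = g^(i^2) holds at both i and
   i + l modulo n, these points lie in the same coset C_{l,i}, and dividing the
   two equations gives g^(2il + l^2) = g^(lr), that is 2i + l = r modulo m.
   This congruence has at most 2l solutions modulo n.  If b residues modulo n
   are bad, then all but 2b residues i are of this kind, so n <= 2b + 2l, and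
   b <= n - |S| because S injects into the good residues. *)

Lemma zexpg_modz (gT : finGroupType) (g : gT) (x : int) :
  zexpg g x = (g ^+ `|(x %% #[g]%g)%Z|)%g.
Proof.
have n0 := order_gt0 g.
have nz : (#[g]%g)%:Z != 0 by lia.
have := divz_eq x #[g]%g; have := modz_ge0 x nz.
case: x => k /=; first by rewrite modz_nat absz_nat expg_mod_order.
set y := (_ %% _)%Z; set z := (_ %/ _)%Z => y0 kE.
(* For the negative integer [- k.+1], clearing the inverse leaves the exponent [k.+1 + y], which is
   [- z] times the order. *)
apply: (mulgI (g ^+ k.+1)%g); rewrite mulgV -expgD.
suff -> : (k.+1 + `|y| = `|z| * #[g]%g)%N.
  by rewrite mulnC expgM expg_order expg1n.
by nia.
Qed.

(** Solutions share the remainder of [2 * i] modulo [m], so the quotient [(2 * i) %/ m], which is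
    below [2 * l], determines [i]. This covers both parities of [m] at once. *)
Lemma card_double_mod_le (l m c : nat) :
  (#|[set i : 'I_(l * m) | 2 * i == c %[mod m]]| <= 2 * l)%N.
Proof.
have [->|m0] := posnP m.
  by rewrite (leq_trans (max_card _)) // card_ord muln0.
have lt_h (i : 'I_(l * m)) : ((2 * i) %/ m < 2 * l)%N.
  by rewrite ltn_divLR // -mulnA ltn_pmul2l.
set A := [set i | _].
rewrite -(card_ord (2 * l)) -(@card_in_imset _ _ (fun i => Ordinal (lt_h i)) A).
  exact: max_card.
move=> i j; rewrite !inE => /eqP ci /eqP cj [qE]; apply/val_inj/eqP.
by rewrite -(eqn_pmul2l (m := 2)) // (divn_eq (2 * i) m) (divn_eq (2 * j) m)
           qE ci cj.
Qed.

Section SquareMap.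

Variables (gT : finGroupType) (g : gT) (f : [subg <[g]> ] -> [subg <[g]> ]).

Let c (i : nat) : [subg <[g]> ] := subg <[g]> (g ^+ i)%g.

Definition square_points : {set 'I_#[g]%g} := [set i : 'I_#[g]%g | f (c i) == c (i ^ 2)].

Lemma sgval_cycle_exp (i : nat) : sgval (c i) = (g ^+ i)%g.
Proof. by rewrite subgK ?mem_cycle. Qed.

Lemma cycle_expM (i j : nat) : (c i * c j)%g = c (i + j).
Proof.
by rewrite /c -subgM ?mem_cycle // expgD.
Qed.

Lemma cycle_expX (i r : nat) : (c i ^+ r)%g = c (i * r).
Proof.
elim: r => [|r IHr]; last by rewrite expgS IHr cycle_expM mulnS.
by rewrite expg0 muln0; apply: subg_inj; rewrite sgval_cycle_exp.
Qed.

Lemma cycle_exp_inj (i j : nat) : c i = c j -> i = j %[mod #[g]%g].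
Proof.
by move/(congr1 sgval)/eqP; rewrite !sgval_cycle_exp eq_expg_mod_order => /eqP.
Qed.

Lemma mem_cyc_coset (l i : nat) : (0 < l)%N -> (l %| #[g]%g)%N ->
  (i < #[g]%g)%N -> (g ^+ i)%g \in cyc_coset g l (i %% l).
Proof.
move=> l0 ln lt_in; apply/lcosetP.
have lt_j : (i %/ l < #[g]%g %/ l)%N by rewrite ltn_divLR // divnK.
exists (g ^+ (i %/ l * l))%g; first by apply/imsetP; exists (Ordinal lt_j).
by rewrite -expgD addnC -divn_eq.
Qed.

Lemma order_le_index_bad (l : nat) : index_pred f l ->
  (#[g]%g <= 2 * #|~: square_points| + 2 * l)%N.
Proof.
case/and3P=> l0 ln /asboolP[r [a [_ fE]]].
pose m := (#[g]%g %/ l)%N.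
have nE : #[g]%g = (l * m)%N by rewrite mulnC divnK.
have n0 := order_gt0 g.
pose sh (i : 'I_#[g]%g) : 'I_#[g]%g := Ordinal (ltn_pmod (i + l) n0).
have sh_inj : injective sh.
  move=> i j [] /eqP; rewrite eqn_modDr => /eqP.
  by rewrite !modn_small // => /val_inj.
have m_gt0 : (0 < m)%N by rewrite divn_gt0 // dvdn_leq.
(* In natural numbers, [l * m - l] stands for [- l] modulo [m]. *)
pose A := [set i : 'I_#[g]%g | 2 * i == r + (l * m - l) %[mod m]].
have cardA : (#|A| <= 2 * l)%N.
  rewrite /A; move: (r + _)%N; rewrite nE => k.
  exact: card_double_mod_le.
(* Since [sh] is a bijection, the preimage has as many elements as the bad set itself, whence the
   factor 2. *)
suff cov : setT \subset (~: square_points :|: sh @^-1: ~: square_points) :|: A.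
  rewrite -[X in (X <= _)%N](card_ord #[g]%g) -cardsT.
  apply: leq_trans (subset_leq_card cov) _.
  apply: leq_trans (leq_card_setU _ _) _; apply: leq_add => //.
  apply: leq_trans (leq_card_setU _ _) _.
  by rewrite mul2n -addnn leq_add2l on_card_preimset //; apply: onW_bij;
     apply: injF_bij.
apply/subsetP=> i _; rewrite !inE.
case: eqP => //= fi; case: eqP => //= fsi.
have lt_il : (i %% l < l)%N by rewrite ltn_mod.
have formE (k : 'I_#[g]%g) : k = i %[mod l] ->
    f (c k) = (a (Ordinal lt_il) * c k ^+ r)%g.
  move=> kE; apply: fE; rewrite sgval_cycle_exp /= -kE.
  exact: mem_cyc_coset.
(* Wrapping around the order preserves the coset, because [l] divides the order. *)
have shE : (sh i : nat) = i %[mod l] by rewrite /= modn_dvdm // modnDr.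
have fi_eq := formE i erefl; have fsi_eq := formE _ shE.
rewrite fi cycle_expX in fi_eq; rewrite /sh /= fsi cycle_expX in fsi_eq.
set i' := ((i + l) %% _)%N in fsi_eq.
(* Cross-multiplying the two equations eliminates the coefficient of the coset without subtracting
   exponents. *)
have /cycle_exp_inj : c (i ^ 2 + i' * r) = c (i' ^ 2 + i * r).
  by rewrite -!cycle_expM fi_eq fsi_eq -!mulgA !cycle_expM addnC.
have i'E : i' = i + l %[mod #[g]%g] by rewrite modn_mod.
rewrite -modnDmr -modnMml i'E modnMml modnDmr.
rewrite -[RHS]modnDml -modnXm i'E modnXm modnDml => E.
suff : (l * (2 * i + l) == l * r %[mod l * m])%N.
  rewrite -!muln_modr eqn_pmul2l // -(eqn_modDr (l * m - l)).
  by rewrite -addnA subnKC ?leq_pmulr // addnC modnMDl.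
(* Adding this term turns the two sides into those of [E]. *)
rewrite eq_sym -(eqn_modDl (i ^ 2 + i * r)).
have -> : (i ^ 2 + i * r + l * r = i ^ 2 + (i + l) * r)%N by ring.
have -> : (i ^ 2 + i * r + l * (2 * i + l) = (i + l) ^ 2 + i * r)%N by ring.
by rewrite -nE E.
Qed.

Lemma card_square_points (N H : int) (S : {fset int}) :
  H <= (#[g]%g)%:Z ->
  (forall x : int, x \in S -> N + 1 <= x <= N + H) ->
  (forall x : int, x \in S ->
     f (subg <[g]> (zexpg g x)) = subg <[g]> (zexpg g (x ^+ 2))) ->
  (#|` S| <= #|square_points|)%N.
Proof.
move=> leH winS fS; have n0 := order_gt0 g.
have n0' : 0 < (#[g]%g)%:Z by lia.
have nz : (#[g]%g)%:Z != 0 by lia.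
have lt_o (x : int) : (`|(x %% #[g]%g)%Z| < #[g]%g)%N.
  by have := ltz_pmod x n0'; have := modz_ge0 x nz; lia.
pose o x := Ordinal (lt_o x).
have o_inj : {in S &, injective o}.
  move=> x y /winS xw /winS yw [] oE.
  have := modz_ge0 x nz; have := modz_ge0 y nz.
  move: oE (divz_eq x #[g]%g) (divz_eq y #[g]%g).
  move: (x %/ _)%Z (y %/ _)%Z (x %% _)%Z (y %% _)%Z => u v x' y' oE xE yE y0 x0.
  (* With equal remainders, distinct quotients would put [x] and [y] at least the order apart, but a
     window of [H] consecutive integers is too short for that. *)
  by have [?|?|?] := ltgtP u v; nia.
rewrite -(size_map o); apply: leq_trans (_ : #|map o S| <= _)%N.
  by rewrite (card_uniqP _) // map_inj_in_uniq ?fset_uniq.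
apply/subset_leq_card/subsetP=> _ /mapP[x xS ->]; rewrite inE.
rewrite /c /= -zexpg_modz fS //.
rewrite zexpg_modz -modzXm -[in X in _ == X]expg_mod_order.
have := modz_ge0 x nz; case: (x %% _)%Z => // k _.
by rewrite -rmorphXn /= modz_nat absz_nat.
Qed.

End SquareMap.

Theorem theorem5 (F : finFieldType) (q n : nat) (gamma : {unit F})
    (N H s : int) (S : {fset int})
    (f : [subg <[gamma]> ] -> [subg <[gamma]> ]) :
  #|F| = q -> (2 <= n)%N -> (n %| q - 1)%N -> #[gamma]%g = n ->
  H <= n%:Z -> 0 <= s ->
  (forall x : int, x \in S -> N + 1 <= x <= N + H) ->
  (#|` S|)%:Z = H - s ->
  (forall x : int, x \in S ->
     f (subg <[gamma]> (zexpg gamma x)) = subg <[gamma]> (zexpg gamma (x ^+ 2))) ->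
  n%:Q / (2 * (n%:Z - H + 2 * s + 1))%:Q <= (ind f)%:Q.
Proof.
move=> _ _ _ gn leH s0 winS cardS fS; rewrite -gn in leH *.
have le_good := card_square_points leH winS fS.
rewrite /ind; case: ex_minnP => l idx _.
have le_n := order_le_index_bad idx.
have l0 : (0 < l)%N by case/and3P: idx.
have := cardsC (square_points f); rewrite card_ord => cardC.
have d0 : 0 < 2 * (#[gamma]%g%:Z - H + 2 * s + 1) by lia.
rewrite ler_pdivrMr ?ltr0z // -intrM ler_int.
(* Put [d = n - H + s], which is nonnegative and bounds the number of bad residues. Then
   [n <= 2 * d + 2 * l <= 2 * l * (d + 1)] as [l >= 1], and [d + 1 <= n - H + 2 * s + 1]. *)
nia.
Qed.
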